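(* $\mathscr{F}_{\mathrm{opt}} \cap \mathscr{F}_{\mathrm{AIFV}} \neq \emptyset$. That is, there exists an AIFV code-tuple which attains the minimum average codeword length $L(F)$ over all regular, extendable, $2$-bit delay decodable code-tuples $F$ (with any finite number of code tables).
   Context: Throughout, $\mathcal{S}$ is a finite source alphabet with $|\mathcal{S}|\ge 2$ and $\mathcal{C}=\{0,1\}$. For a set $\mathcal{A}$, $\mathcal{A}^k$, $\mathcal{A}^{\ast}$, $\mathcal{A}^{+}$ denote the sets of sequences over $\mathcal{A}$ of length $k$, of finite length, and of finite positive length; $\lambda$ is the empty sequence and $|\pmb{x}|$ the length. $\pmb{x}\preceq\pmb{y}$ means $\pmb{y}=\pmb{x}\pmb{z}$ for some (possibly empty) $\pmb{z}$, and $\pmb{x}\prec\pmb{y}$ means $\pmb{x}\preceq\pmb{y}$ and $\pmb{x}\neq\pmb{y}$. For nonempty $\pmb{x}=x_1\cdots x_n$, $\mathrm{suff}(\pmb{x})=x_2\cdots x_n$. A code-tuple $F$ with $m\ge 1$ code tables is a tuple $(f_0,\dots,f_{m-1},\tau_0,\dots,\tau_{m-1})$ of maps $f_i:\mathcal{S}\to\mathcal{C}^{\ast}$ and $\tau_i:\mathcal{S}\to\{0,\dots,m-1\}$; write $|F|=m$, $[F]=\{0,\dots,m-1\}$. For $i\in[F]$ define $f_i^{\ast}:\mathcal{S}^{\ast}\to\mathcal{C}^{\ast}$, $\tau_i^{\ast}:\mathcal{S}^{\ast}\to[F]$ by $f_i^{\ast}(\lambda)=\lambda$, $\tau_i^{\ast}(\lambda)=i$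 and, for $\pmb{x}=x_1\cdots x_n\neq\lambda$, $f_i^{\ast}(\pmb{x})=f_i(x_1)f^{\ast}_{\tau_i(x_1)}(\mathrm{suff}(\pmb{x}))$, $\tau_i^{\ast}(\pmb{x})=\tau^{\ast}_{\tau_i(x_1)}(\mathrm{suff}(\pmb{x}))$. For an integer $k\ge 0$ and $\pmb{b}\in\mathcal{C}^{\ast}$, $\mathcal{P}^k_{F,i}(\pmb{b})$ is the set of $\pmb{c}\in\mathcal{C}^k$ such that some $\pmb{x}=x_1\cdots x_n\in\mathcal{S}^{+}$ satisfies $f_i^{\ast}(\pmb{x})\succeq\pmb{b}\pmb{c}$ and $f_i(x_1)\succeq\pmb{b}$; $\bar{\mathcal{P}}^k_{F,i}(\pmb{b})$ is defined the same way with $f_i(x_1)\succ\pmb{b}$. Write $\mathcal{P}^k_{F,i}=\mathcal{P}^k_{F,i}(\lambda)$, $\bar{\mathcal{P}}^k_{F,i}=\bar{\mathcal{P}}^k_{F,i}(\lambda)$. $F$ is $k$-bit delay decodable if (i) $\mathcal{P}^k_{F,\tau_i(s)}\cap\bar{\mathcal{P}}^k_{F,i}(f_i(s))=\emptyset$ for all $i\in[F]$, $s\in\mathcal{S}$, and (ii) $\mathcal{P}^k_{F,\tau_i(s)}\cap\mathcal{P}^k_{F,\tau_i(s')}=\emptyset$ whenever $i\in[F]$, $s\neq s'$ and $f_i(s)=f_i(s')$; $\mathscr{F}_{2\text{-}\mathrm{dec}}$ is the set of $2$-bit delay decodable code-tuples. $F$ is extendable if $\mathcal{P}^1_{F,i}\neq\emptyset$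 for all $i\in[F]$; $\mathscr{F}_{\mathrm{ext}}$ is the set of extendable code-tuples. Fix $\mu:\mathcal{S}\to(0,1]$ with $\sum_{s}\mu(s)=1$. For a code-tuple $F$ let $Q(F)$ be the $|F|\times|F|$ matrix with entries $Q_{i,j}(F)=\sum_{s:\tau_i(s)=j}\mu(s)$. $F$ is regular if the system $\pmb{\pi}Q(F)=\pmb{\pi}$, $\sum_{i\in[F]}\pi_i=1$ has a unique solution $\pmb{\pi}(F)=(\pi_0(F),\dots,\pi_{|F|-1}(F))$; $\mathscr{F}_{\mathrm{reg}}$ is the set of regular code-tuples. Let $L_i(F)=\sum_{s}|f_i(s)|\mu(s)$ and, for regular $F$, $L(F)=\sum_{i\in[F]}\pi_i(F)L_i(F)$. Let $\mathscr{F}_0=\mathscr{F}_{\mathrm{reg}}\cap\mathscr{F}_{\mathrm{ext}}\cap\mathscr{F}_{2\text{-}\mathrm{dec}}$ and $\mathscr{F}_{\mathrm{opt}}=\{F\in\mathscr{F}_0: L(F)\le L(F')\text{ for all }F'\in\mathscr{F}_0\}$. $\mathscr{F}_{\mathrm{AIFV}}$ is the set of code-tuples $F$ with $|F|=2$ satisfying: (i) $f_0,f_1$ are injective; (ii) for all $i\in\{0,1\}$, $s\in\mathcal{S}$: $1\notin\bar{\mathcal{P}}^1_{F,i}(f_i(s))$ and $1\notin\bar{\mathcal{P}}^1_{F,i}(f_i(s)0)$; (iii) $f_i(s')\neq f_i(s)0$ for all $i\in\{0,1\}$, $s,s'\in\mathcal{S}$; (iv) for all $i,s$: $\tau_i(s)=0$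 if $\bar{\mathcal{P}}^0_{F,i}(f_i(s))=\emptyset$ and $\tau_i(s)=1$ otherwise; (v) $f_1(s)\neq\lambda$ and $f_1(s)\neq 0$ for all $s$; (vi) $0\notin\bar{\mathcal{P}}^1_{F,1}(0)$; (vii) for all $i\in\{0,1\}$ and $\pmb{b}\in\mathcal{C}^{\ast}$ with $|\bar{\mathcal{P}}^1_{F,i}(\pmb{b})|=1$, either $f_i(s)\pmb{c}=\pmb{b}$ for some $s\in\mathcal{S}$ and $\pmb{c}\in\mathcal{C}^0\cup\mathcal{C}^1$, or $(i,\pmb{b})=(1,0)$. *)

(* Defs.v *)
From HB Require Import structures.
From mathcomp Require Import all_boot all_order all_algebra.
From mathcomp Require Import reals.
Set Implicit Arguments. Unset Strict Implicit. Unset Printing Implicit Defensive.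
Import Order.TTheory GRing.Theory Num.Theory.
Local Open Scope ring_scope.

(* Code alphabet C = {0,1} is encoded as bool: false = 0, true = 1. *)

Definition pre (x y : seq bool) : Prop := exists z, y = x ++ z.
Definition spre (x y : seq bool) : Prop := pre x y /\ x <> y.

Record codeTuple (S : Type) := CodeTuple {
  ct_n : nat;
  ct_pos : (0 < ct_n)%N;
  ct_f : 'I_ct_n -> S -> seq bool;
  ct_tau : 'I_ct_n -> S -> 'I_ct_n }.

Section CodeTuples.
Variable S : finType.
Implicit Types (F : codeTuple S).

Fixpoint fstar F (i : 'I_(ct_n F)) (x : seq S) : seq bool :=
  match x with
  | [::] => [::]
  | s :: x' => ct_f i s ++ fstar (ct_tau i s) x'
  end.

Fixpoint taustar F (i : 'I_(ct_n F)) (x : seq S) : 'I_(ct_n F) :=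
  match x with
  | [::] => i
  | s :: x' => taustar (ct_tau i s) x'
  end.

Definition Pk F (k : nat) (i : 'I_(ct_n F)) (b c : seq bool) : Prop :=
  size c = k /\
  exists (x1 : S) (xs : seq S),
    pre (b ++ c) (fstar i (x1 :: xs)) /\ pre b (ct_f i x1).

Definition Pbark F (k : nat) (i : 'I_(ct_n F)) (b c : seq bool) : Prop :=
  size c = k /\
  exists (x1 : S) (xs : seq S),
    pre (b ++ c) (fstar i (x1 :: xs)) /\ spre b (ct_f i x1).

Definition k_bit_delay_decodable (k : nat) F : Prop :=
  (forall (i : 'I_(ct_n F)) (s : S) (c : seq bool),
      ~ (Pk k (ct_tau i s) [::] c /\ Pbark k i (ct_f i s) c)) /\
  (forall (i : 'I_(ct_n F)) (s s' : S), s <> s' -> ct_f i s = ct_f i s' ->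
      forall c : seq bool,
        ~ (Pk k (ct_tau i s) [::] c /\ Pk k (ct_tau i s') [::] c)).

Definition two_bit_delay_decodable F : Prop := k_bit_delay_decodable 2 F.

Definition extendable F : Prop :=
  forall i : 'I_(ct_n F), exists c, Pk 1 i [::] c.

Section Lengths.
Variables (R : realType) (mu : S -> R).

Definition Qmat F : 'M[R]_(ct_n F) :=
  \matrix_(i, j) \sum_(s | ct_tau i s == j) mu s.

Definition stationary F (pi : 'rV[R]_(ct_n F)) : Prop :=
  pi *m Qmat F = pi /\ \sum_(i < ct_n F) pi 0 i = 1.

Definition regular F : Prop := exists! pi : 'rV[R]_(ct_n F), stationary pi.

Definition Li F (i : 'I_(ct_n F)) : R := \sum_s (size (ct_f i s))%:R * mu s.

(* sum_i pi_i L_i(F); for regular F and pi = pi(F) this is L(F) *)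
Definition avgL F (pi : 'rV[R]_(ct_n F)) : R := \sum_(i < ct_n F) pi 0 i * Li i.

Definition inF0 F : Prop := regular F /\ extendable F /\ two_bit_delay_decodable F.

(* F \in F_opt : L(F) <= L(F') for all F' \in F_0, where L(.) is computed from
   the (unique, by regularity) stationary vectors. *)
Definition inFopt F : Prop :=
  inF0 F /\
  forall F' : codeTuple S, inF0 F' ->
    forall (pi : 'rV[R]_(ct_n F)) (pi' : 'rV[R]_(ct_n F')),
      stationary pi -> stationary pi' -> avgL pi <= avgL pi'.
End Lengths.

Definition inAIFV F : Prop :=
  ct_n F = 2%N /\
  (forall i : 'I_(ct_n F), injective (ct_f i)) /\
  (forall (i : 'I_(ct_n F)) (s : S),
      ~ Pbark 1 i (ct_f i s) [:: true] /\
      ~ Pbark 1 i (ct_f i s ++ [:: false]) [:: true]) /\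
  (forall (i : 'I_(ct_n F)) (s s' : S), ct_f i s' <> ct_f i s ++ [:: false]) /\
  (forall (i : 'I_(ct_n F)) (s : S),
      ((~ exists c, Pbark 0 i (ct_f i s) c) -> val (ct_tau i s) = 0%N) /\
      ((exists c, Pbark 0 i (ct_f i s) c) -> val (ct_tau i s) = 1%N)) /\
  (forall (i : 'I_(ct_n F)) (s : S), val i = 1%N ->
      ct_f i s <> [::] /\ ct_f i s <> [:: false]) /\
  (forall i : 'I_(ct_n F), val i = 1%N -> ~ Pbark 1 i [:: false] [:: false]) /\
  (forall (i : 'I_(ct_n F)) (b : seq bool),
      (exists! c, Pbark 1 i b c) ->
      (exists (s : S) (c : seq bool), (size c <= 1)%N /\ ct_f i s ++ c = b)
      \/ (val i = 1%N /\ b = [:: false])).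

End CodeTuples.

(* Main.v *)
Require Import Defs.
From HB Require Import structures.
From mathcomp Require Import all_boot all_order all_algebra.
From mathcomp Require Import reals boolp ring lra.
Set Implicit Arguments. Unset Strict Implicit. Unset Printing Implicit Defensive.
Import Order.TTheory GRing.Theory Num.Theory.
Local Open Scope ring_scope.

(** Only the set [T] of possible next two bits at a state matters for 2-bit
    delay decoding: a table is decodable exactly when the cylinders
    [f s ++ c], [c] in the lookahead set of [tau s], are disjoint over [s].
    Give [T] the bias 0, d, 1, 2 when it has 4, 3, 2, 1 elements.  Permuting
    grandchildren of a node turns every such packing of cylinders into a tree in
    which each symbol sits at a leaf (full lookahead) or at an inner node whose
    only descendants pass through 00 (lookahead {01, 10, 11}), without
    increasing the biased cost; these trees are the AIFV tables.  Choosing [d]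
    so that the cheapest trees of the two AIFV states balance, the bias is a
    solution of the Bellman equation of the average cost, and summing the
    inequality against a stationary vector bounds [L] from below by the value of
    the optimal pair of trees. *)

(** * Cylinders of bit streams and their relative position *)

Section Cylinders.
Implicit Types (A T : bool -> bool -> bool) (w p : seq bool) (z : nat -> bool).

(* A set of two-bit words is a predicate [A] on pairs of bits, and [cyl w A] is
   the set of infinite bit streams that start with [w ++ c] for some [c] in [A]. *)
Fixpoint cyl w A z : bool :=
  if w is b :: w' then (z 0%N == b) && cyl w' A (fun n => z n.+1)
  else A (z 0%N) (z 1%N).

Fixpoint app p z : nat -> bool :=
  if p is b :: p' then fun n => if n is n'.+1 then app p' z n' else b else z.

(* Once the non-spread [A], contained in the half with a fixed first bit, are
   absorbed into [w], two distinct disjoint cylinders interact only in the ways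
   listed in [root_other]. *)
Definition spread A := (A false false || A false true) && (A true false || A true true).

Definition nwords A : nat := A false false + A false true + A true false + A true true.

Lemma cyl_app p w A z : cyl (p ++ w) A (app p z) = cyl w A z.
Proof. by elim: p => //= b p ->; rewrite eqxx. Qed.

Lemma spreadP A x : spread A -> exists y, A x y.
Proof.
by case/andP; case: x => /orP[] ? /orP[] ?;
  ((exists false; assumption) || (exists true; assumption)).
Qed.

Lemma spread_ne w A : spread A -> exists z, cyl w A z.
Proof.
move=> /(spreadP false)[y Ay].
exists (app w (app [:: false; y] (fun=> false))).
by rewrite -{1}(cats0 w) cyl_app.
Qed.

(** With [w] empty, two disjoint sets that both meet each half take one word apiece in it. With [w]
    a single bit [x], some word [x y] lies in [A] and some word of [A'] starts with that [y], so the
    cylinders meet. *)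
Lemma root_other A w A' : spread A -> spread A' ->
  (forall z, A (z 0%N) (z 1%N) -> ~~ cyl w A' z) ->
  (w = [::] /\ forall x y, A' x y = ~~ A x y) \/
  exists x y w', w = [:: x, y & w'] /\ ~~ A x y.
Proof.
move=> sA sA' dis; case: w dis => [|x [|y w]] dis.
- left; split=> // x y.
  have E u v : A u v -> ~~ A' u v by move/(dis (app [:: u; v] (fun=> false))).
  case Axy: (A x y); first exact/negbTE/E.
  have [y1 H1] := spreadP x sA; have [y2 H2] := spreadP x sA'.
  have := E _ _ H1.
  by case: y y1 y2 Axy H1 H2 => [] [] [] Axy H1 H2; rewrite ?Axy ?H1 ?H2 // in H1 *.
- have [y Ay] := spreadP x sA; have [y' Ay'] := spreadP y sA'.
  by have := dis (app [:: x; y; y'] (fun=> false)) Ay; rewrite /= eqxx Ay'.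
- right; exists x, y, w; split=> //; apply/negP=> Axy.
  have [z Hz] := spread_ne w sA'.
  have := dis (app [:: x; y] z) Axy.
  by rewrite -/([:: x; y] ++ w) cyl_app Hz.
Qed.

End Cylinders.

(** * Biases of two-bit sets and reduction to spread sets *)

Section Bias.
Variables (R : realFieldType) (d : R).
Implicit Types (A T : bool -> bool -> bool).

(** This is [2 - log2 (nwords A)], except that the free parameter [d] stands in at three words. The
    default branch also catches the empty set, which extendability excludes through
    [lookahead_ne]. *)
Definition bias A : R :=
  match nwords A with 4 => 0 | 3 => d | 2 => 1 | _ => 2 end.

Lemma bias_ge0 A : 0 <= d -> 0 <= bias A.
Proof. by rewrite /bias; case: (nwords A) => [|[|[|[|[|n]]]]]. Qed.

(** A nonempty set that is not spread is a whole half or a single word, that is, everything below a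
    prefix of 1 or 2 bits. That length is its bias, so the prefix can move into the codeword. *)
Lemma normalize w A : (exists x y, A x y) ->
  exists w' A', [/\ spread A', forall z, cyl w' A' z = cyl w A z
    & (size w')%:R + bias A' = (size w)%:R + bias A].
Proof.
move=> neA.
suff [p [A' [sA' cA' bA']]] : exists p A', [/\ spread A',
    forall z, cyl p A' z = A (z 0%N) (z 1%N) & (size p)%:R + bias A' = bias A].
  exists (w ++ p), A'; split=> //; last by rewrite size_cat natrD -addrA bA'.
  by elim: w => //= b w IH z; rewrite IH.
have [sA|nsA] := boolP (spread A); first by exists [::], A; rewrite add0r.
have full_card : bias (fun _ _ => true) = 0 by [].
suff [p [Hp Hs]] : exists p : seq bool,
    (forall z, cyl p (fun _ _ => true) z = A (z 0%N) (z 1%N)) /\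
    (size p)%:R = bias A.
  by exists p, (fun _ _ => true); rewrite full_card addr0.
have [x [y Axy]] := neA; rewrite /bias /nwords.
move: nsA; rewrite /spread.
case E00: (A false false); case E01: (A false true);
  case E10: (A true false); case E11: (A true true) => //= _.
all: try by move: x y Axy => [] []; rewrite ?E00 ?E01 ?E10 ?E11.
(* Six patterns are left: in each half, the whole half or one of its two words. *)
all: [> exists [:: false] | exists [:: false; false] | exists [:: false; true]
  | exists [:: true] | exists [:: true; false] | exists [:: true; true]].
all: by split=> // z /=; case: (z 0%N); case: (z 1%N); rewrite ?E00 ?E01 ?E10 ?E11.
Qed.

End Bias.

(* [Hole s u] puts [s] at an inner node and the root of [u] two bits below, at 00. *)
Inductive tree (S : Type) :=
  | Leaf of S
  | Br of tree S & tree S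
  | Hole of S & tree S.

Fixpoint syms (S : Type) (t : tree S) : seq S :=
  match t with
  | Leaf s => [:: s]
  | Br u v => syms u ++ syms v
  | Hole s u => s :: syms u
  end.

(** * Tree costs and the operations that build cheap trees *)

Section Costs.
Variables (R : realFieldType) (S : eqType) (mu : S -> R).
Hypothesis mu_gt0 : forall s, 0 < mu s.
Implicit Types (t u v : tree S) (X Y : seq S).

Definition wt X : R := \sum_(s <- X) mu s.

Fixpoint len t : R :=
  match t with
  | Leaf _ => 0
  | Br u v => len u + len v + wt (syms u) + wt (syms v)
  | Hole _ u => len u + 2 * wt (syms u)
  end.

Fixpoint hol t : R :=
  match t with
  | Leaf _ => 0
  | Br u v => hol u + hol v
  | Hole s u => mu s + hol u
  end.

(* The table of the second AIFV state has codewords 01x, x in [u], and 1y, y in [v]. *)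
Definition len1 u v : R := len u + len v + 2 * wt (syms u) + wt (syms v).

Lemma wt_perm X Y : perm_eq X Y -> wt X = wt Y.
Proof. exact: perm_big. Qed.

Lemma wt_cat X Y : wt (X ++ Y) = wt X + wt Y.
Proof. exact: big_cat. Qed.

Lemma wt_cons s X : wt (s :: X) = mu s + wt X.
Proof. exact: big_cons. Qed.

Lemma wt_ge0 X : 0 <= wt X.
Proof. by apply: sumr_ge0 => s _; exact: ltW. Qed.

Lemma hol_ge0 t : 0 <= hol t.
Proof.
by elim: t => [s|u IHu v IHv|s u IHu] //=; rewrite addr_ge0 // ltW.
Qed.

(** Strict because every tree ends in a leaf, whose weight [hol] leaves out. This keeps the
    probability of staying in the second state below 1. *)
Lemma hol_lt t : hol t < wt (syms t).
Proof.
elim: t => [s|u IHu v IHv|s u IHu] //=.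
- by rewrite /wt big_seq1.
- by rewrite wt_cat ltrD.
- by rewrite wt_cons ltrD2l.
Qed.

Variables (d : R).
Hypothesis d_ge0 : 0 <= d.
Implicit Types (c : S -> R).

(** The budget [c] is an arbitrary function, so that cutting a common prefix of length k off the
    codewords is the passage from [c] to [c - k]. *)
Definition solved X c := exists t,
  perm_eq (syms t) X /\ len t + d * hol t <= \sum_(s <- X) mu s * c s.

Definition solved1 X c := exists u v, perm_eq (syms u ++ syms v) X /\
  len1 u v + d * (hol u + hol v) <= \sum_(s <- X) mu s * c s.

Lemma solved_leaf s c : 0 <= c s -> solved [:: s] c.
Proof.
move=> cs; exists (Leaf s); split=> //=.
by rewrite big_seq1 mulr0 addr0 mulr_ge0 // ltW.
Qed.

Lemma solved_perm X Y c : perm_eq X Y -> solved X c -> solved Y c.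
Proof.
move=> pXY [t [pt ct]]; exists t; split; first exact: perm_trans pt pXY.
by rewrite -(perm_big _ pXY).
Qed.

Lemma solved_mono X c c' :
  {in X, forall s, c' s <= c s} -> solved X c' -> solved X c.
Proof.
move=> cc [t [pt ct]]; exists t; split=> //; apply: le_trans ct _.
by rewrite big_seq [leRHS]big_seq; apply: ler_sum => s /cc H; rewrite ler_pM2l.
Qed.

Lemma sum_shift X c (k : R) :
  \sum_(s <- X) mu s * (c s - k) = \sum_(s <- X) mu s * c s - k * wt X.
Proof.
rewrite /wt mulr_sumr -sumrB; apply: eq_bigr => s _; ring.
Qed.

Lemma solved_br X Y c : solved X (fun s => c s - 1) ->
  solved Y (fun s => c s - 1) -> solved (X ++ Y) c.
Proof.
move=> [u [pu cu]] [v [pv cv]]; exists (Br u v); split; first exact: perm_cat.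
rewrite big_cat /= (wt_perm pu) (wt_perm pv).
move: cu cv; rewrite !sum_shift; lra.
Qed.

Lemma solved_hole s X c : d <= c s -> solved X (fun s => c s - 2) ->
  solved (s :: X) c.
Proof.
move=> cs [u [pu cu]]; exists (Hole s u); split; first by rewrite /= perm_cons.
rewrite big_cons /= (wt_perm pu).
move: cu; rewrite sum_shift => cu.
have : mu s * d <= mu s * c s by rewrite ler_pM2l.
lra.
Qed.

(** [P] plays the first bit. If one side is empty, no node with a single child is created: the tree
    of the other side is kept and even saves 1. *)
Lemma solved_split (P : pred S) X c : X != [::] ->
  (forall b, let Y := [seq s <- X | P s == b] in Y != [::] ->
    solved Y (fun s => c s - 1)) -> solved X c.
Proof.
move=> X0 H.
have pX : perm_eq ([seq s <- X | P s == true] ++ [seq s <- X | P s == false]) X.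
  rewrite [X in _ ++ X](eq_filter (a2 := predC (fun s => P s == true))).
    exact/permPl/perm_filterC.
  by move=> s /=; case: (P s).
apply: (solved_perm pX).
have [Y1|Y1] := eqVneq [seq s <- X | P s == true] [::];
  have [Y2|Y2] := eqVneq [seq s <- X | P s == false] [::].
- by move: pX X0; rewrite Y1 Y2 perm_sym => /perm_nilP ->.
- rewrite Y1 /=; apply: solved_mono (H false Y2) => s _; lra.
- rewrite Y2 cats0; apply: solved_mono (H true Y1) => s _; lra.
- by apply: solved_br; exact: H.
Qed.

(* A node with a single child can be contracted, so a 1-table whose codewords
   all start with 1 is dominated by one with both children present. *)
Lemma solved_solved1 X c : (1 < size X)%N -> solved X (fun s => c s - 1) ->
  solved1 X c.
Proof.
move=> X1 [t [pt ct]]; move: ct; rewrite sum_shift -(wt_perm pt) /solved1 => ct.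
case: t pt ct => [s|u v|s u] pt ct.
- by rewrite -(perm_size pt) in X1.
- exists u, v; split=> //; move: ct.
  have := wt_ge0 (syms v); rewrite /= wt_cat /len1; lra.
- exists u, (Leaf s); split; first by rewrite /= cats1 (perm_trans _ pt) // perm_rcons.
  move: ct; rewrite /= /len1 /= !wt_cons [wt [::]]big_nil.
  have := wt_ge0 (syms u); have := mu_gt0 s.
  have : 0 <= d * mu s by rewrite mulr_ge0 // ltW.
  lra.
Qed.

Lemma solved_pair X Y c : solved X (fun s => c s - 2) ->
  solved Y (fun s => c s - 1) -> solved1 (X ++ Y) c.
Proof.
move=> [u [pu cu]] [v [pv cv]]; exists u, v; split; first exact: perm_cat.
rewrite big_cat /= /len1 (wt_perm pu) (wt_perm pv).
move: cu cv; rewrite !sum_shift; lra.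
Qed.

Lemma solved1_perm X Y c : perm_eq X Y -> solved1 X c -> solved1 Y c.
Proof.
move=> pXY [u [v [pt ct]]]; exists u, v; split; first exact: perm_trans pt pXY.
by rewrite -(perm_big _ pXY).
Qed.

(** * Packings of disjoint cylinders turned into trees *)

Section Configurations.
Variable A : S -> bool -> bool -> bool.
Hypothesis spA : forall s, spread (A s).
Implicit Types (w : S -> seq bool).

Definition disj X w := forall s s', s \in X -> s' \in X -> s != s' ->
  forall z, cyl (w s) (A s) z -> ~~ cyl (w s') (A s') z.

Definition cst w s : R := (size (w s))%:R + bias d (A s).

Lemma cst_ge0 w s : 0 <= cst w s.
Proof. by rewrite addr_ge0 // bias_ge0. Qed.

Definition solvable n := forall X w, uniq X -> X != [::] ->
  {in X, forall s, (size (w s) < n)%N} -> disj X w -> solved X (cst w).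

Lemma sub_disj X Y w : {subset Y <= X} -> disj X w -> disj Y w.
Proof. by move=> sub D s s' /sub sX /sub sX'; exact: D. Qed.

(** A nonempty common prefix makes the remaining codewords short enough for [solvable n]; its length
    is credited to the budget. *)
Lemma strip_prefix n X w p : solvable n -> p != [::] -> uniq X -> X != [::] ->
  {in X, forall s, (size (w s) < n.+1)%N} ->
  {in X, forall s, prefix p (w s)} -> disj X w ->
  solved X (fun s => cst w s - (size p)%:R).
Proof.
move=> sol p0 uX X0 sz pre D.
pose w' s := drop (size p) (w s).
have Ew s : s \in X -> w s = p ++ w' s.
  by move=> /pre; rewrite prefixE => /eqP {1}<-; rewrite cat_take_drop.
have : solved X (cst w').
  apply: sol => // [s sX|s s' sX s'X ss' z Hz].
    have := sz _ sX; rewrite (Ew _ sX) size_cat => H.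
    by rewrite -ltnS (leq_trans _ H) // ltnS -add1n leq_add2r lt0n size_eq0.
  have := D s s' sX s'X ss' (app p z).
  by rewrite (Ew _ sX) (Ew _ s'X) !cyl_app; apply.
apply: solved_mono => s sX.
by rewrite /cst (Ew _ sX) size_cat natrD; lra.
Qed.

Lemma filter_subset (P : pred S) X : {subset filter P X <= X}.
Proof. by move=> s; rewrite mem_filter => /andP[]. Qed.

(** Each first bit [x] forces the second bit [g x]. Two bits are cut off and the branching on [x]
    pays one back, so the net credit is 1. *)
Lemma strip_two n X w (g : bool -> bool) : solvable n -> uniq X -> X != [::] ->
  {in X, forall s, (size (w s) < n.+1)%N} ->
  {in X, forall s, exists x, prefix [:: x; g x] (w s)} -> disj X w ->
  solved X (fun s => cst w s - 1).
Proof.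
move=> sol uX X0 sz pre D.
apply: (@solved_split (fun s => head false (w s))) => // b Y Y0.
apply: (@solved_mono _ _ (fun s => cst w s - 2)); first by move=> s _; lra.
apply: (strip_prefix sol (p := [:: b; g b])) => //.
- exact: filter_uniq.
- by move=> s /filter_subset; exact: sz.
- move=> s; rewrite mem_filter => /andP[hs /pre[x]].
  case: (w s) hs => [|x' r] //= /eqP -> /andP[/eqP -> //].
  by rewrite eqxx.
- by apply: sub_disj D; exact: filter_subset.
Qed.

(** Induction on a bound for the codeword lengths. Without a symbol at the root, branch on the first
    bit. A root symbol [s] with company leaves three cases by [root_other]: a second symbol at the
    root, or all others below the two grandchildren, or the single one, missing from [A s]. *)
Lemma solvable_all n : solvable n.
Proof.
elim: n => [|n IH] X w uX X0 sz D.
  by case: X X0 sz {uX D} => // s X _ /(_ s (mem_head _ _)).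
have [/hasP[s sX /eqP ws]|noroot] := boolP (has (fun s => w s == [::]) X); last first.
  apply: (@solved_split (fun s => head false (w s))) => // b Y Y0.
  apply: (strip_prefix IH (p := [:: b])) => //.
  - exact: filter_uniq.
  - by move=> s /filter_subset; exact: sz.
  - move=> s; rewrite mem_filter => /andP[hs sX].
    move/hasPn: noroot => /(_ s sX).
    by case: (w s) hs => [|x' r] //= /eqP ->; rewrite eqxx prefix0s.
  - by apply: sub_disj D; exact: filter_subset.
have pX : perm_eq X (s :: rem s X) by exact: perm_to_rem.
apply: (@solved_perm (s :: rem s X)); first by rewrite perm_sym.
set Y := rem s X in pX *.
have YP s' : s' \in Y -> s' \in X /\ s != s'.
  by rewrite mem_rem_uniq // inE => /andP[+ ->]; rewrite eq_sym.
have uY : uniq Y by exact: rem_uniq.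
have [->|Y0] := eqVneq Y [::]; first by apply: solved_leaf; exact: cst_ge0.
have other s' : s' \in Y ->
    (w s' = [::] /\ forall x y, A s' x y = ~~ A s x y) \/
    exists x y r, w s' = [:: x, y & r] /\ ~~ A s x y.
  move=> /YP[s'X ss']; apply: root_other => // z Hz.
  by apply: (D s s') => //; rewrite ws.
have szY : {in Y, forall s, (size (w s) < n.+1)%N} by move=> s' /YP[/sz].
have DY : disj Y w by apply: sub_disj D => s' /YP[].
have [/hasP[s' s'Y /eqP ws']|noroot] := boolP (has (fun s => w s == [::]) Y).
  have [[_ E]|[x [y [r []]]]] := other s' s'Y; last by rewrite ws'.
  have [s'X ss'] := YP _ s'Y.
  (* The complementary sets of [s] and [s'] cover every stream, so a third symbol would meet one of
     them. *)
  have EY : Y = [:: s'].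
    apply: perm_small_eq => //; apply: uniq_perm => // s2; rewrite inE.
    apply/idP/eqP => [s2Y|->//]; apply/eqP/negPn/negP => s2s'.
    have [s2X ss2] := YP _ s2Y.
    have [z Hz] := spread_ne (w s2) (spA s2).
    have := D s2 s s2X sX; rewrite eq_sym ss2 => /(_ isT z Hz); rewrite ws /=.
    have := D s2 s' s2X s'X s2s' z Hz; rewrite ws' /= E.
    by case: (A s _ _).
  rewrite EY -cat1s.
  have : nwords (A s) = 2%N /\ nwords (A s') = 2%N.
    move: (spA s) (spA s'); rewrite /spread /nwords !E.
    by case: (A s false false); case: (A s false true);
       case: (A s true false); case: (A s true true).
  move=> [c2 c2'].
  by apply: solved_br; apply: solved_leaf;
    rewrite /cst ?ws ?ws' /bias ?c2 ?c2' add0r subrr.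
have pY s' : s' \in Y -> exists x y r, w s' = [:: x, y & r] /\ ~~ A s x y.
  move=> s'Y; have [[E _]|//] := other _ s'Y.
  by move/hasPn: noroot => /(_ _ s'Y); rewrite E.
have [s0 s0Y] : exists s0, s0 \in Y.
  by case: Y Y0 {pX YP uY other szY DY noroot pY} => // a l _; exists a; rewrite mem_head.
have [x0 [y0 [r0 [_ A0]]]] := pY s0 s0Y.
have : nwords (A s) = 2%N \/ nwords (A s) = 3%N.
  move: (spA s) A0; rewrite /spread /nwords.
  by case: x0 y0 => [] []; case: (A s false false); case: (A s false true);
       case: (A s true false); case: (A s true true); auto.
case=> cA.
  (* Two words, one per half: [s] becomes a leaf at depth 1, paid for by its bias 1, and the two
     grandchildren left to the others are gathered under the other child at no greater depth. *)
  rewrite -cat1s; apply: solved_br.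
    by apply: solved_leaf; rewrite /cst ws /bias cA add0r subrr.
  (* With one word of [A s] in the half [x], the missing second bit is 1 exactly when [A s x false]
     holds. *)
  apply: (strip_two (g := fun x => A s x false) IH) => // s' s'Y.
  have [x [y [r [-> Axy]]]] := pY _ s'Y; exists x => /=.
  rewrite eqxx prefix0s andbT /=; apply/eqP.
  move: (spA s) cA Axy; rewrite /spread /nwords.
  by case: x y => [] []; case: (A s false false); case: (A s false true);
       case: (A s true false); case: (A s true true).
(* Three words: everyone else passes through the missing word [x0 y0]. Costs see only depths, so
   this word may be renamed 00, as [Hole] requires. *)
apply: solved_hole; first by rewrite /cst ws /bias cA add0r.
apply: (strip_prefix IH (p := [:: x0; y0])) => // s' s'Y.
have [x [y [r [-> Axy]]]] := pY _ s'Y.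
move: cA Axy A0; rewrite /nwords /= prefix0s.
by case: x y x0 y0 => [] [] [] []; case: (A s false false); case: (A s false true);
       case: (A s true false); case: (A s true true).
Qed.

Lemma solvable_config X w : uniq X -> X != [::] -> disj X w -> solved X (cst w).
Proof.
move=> uX X0 D; apply: (@solvable_all (\sum_(s <- X) size (w s)).+1) => // s sX.
by rewrite ltnS (big_rem s) //= leq_addr.
Qed.

(** * Packings confined to a lookahead set [T] *)

Section Inside.
Variables (T : bool -> bool -> bool) (X : seq S) (w : S -> seq bool).
Hypothesis inT :
  {in X, forall s, forall z, cyl (w s) (A s) z -> T (z 0%N) (z 1%N)}.
Hypotheses (uX : uniq X) (X1 : (1 < size X)%N) (D : disj X w).

Let X0 : X != [::]. Proof. by case: X X1. Qed.

Let szw s : s \in X -> (size (w s) < (\sum_(s <- X) size (w s)).+2)%N.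
Proof. by move=> sX; rewrite ltnS leqW // (big_rem s) //= leq_addr. Qed.

Let another s : s \in X -> exists2 s', s' \in X & s != s'.
Proof.
move=> sX; have [/allP H|] := boolP (all (pred1 s) X).
  have : (size X <= size [:: s])%N.
    by apply: uniq_leq_size => // s' /H /=; rewrite inE.
  by rewrite leqNgt X1.
by move=> /allPn[s' s'X /= ss']; exists s'; rewrite // eq_sym.
Qed.

(** If the complement of [T] is spread, it behaves like one more symbol at the root, and
    [root_other] forces every codeword through a word of [T]. Otherwise [T] contains a full half
    and, three words being excluded, is that half or everything. *)
Lemma solved_in : nwords T <> 3%N -> solved X (fun s => cst w s - bias d T).
Proof.
move=> nT3.
have [s1 s1X] : exists s, s \in X.
  by case: X X0 => // s Y _; exists s; rewrite mem_head.
have [spT|/negP nspT] := boolP (spread (fun x y => ~~ T x y)).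
  have pT s : s \in X -> exists x y r, w s = [:: x, y & r] /\ T x y.
    move=> sX.
    have [|||[ws E]|[x [y [r [Ew Txy]]]]] :=
      @root_other (fun x y => ~~ T x y) (w s) (A s) => //.
    - by move=> z; apply: contra => /(inT sX).
    (* Here [s] alone would fill [T], leaving no room for a second symbol. *)
    - have [s' s'X ss'] := another sX; have [z Hz] := spread_ne (w s') (spA s').
      have := D s'X sX; rewrite eq_sym ss' ws => /(_ isT z Hz) /=.
      by rewrite E (inT s'X Hz).
    - by exists x, y, r; move: Txy; rewrite negbK.
  have [x1 [y1 [r1 [_ T1]]]] := pT _ s1X.
  have : nwords T = 1%N \/ nwords T = 2%N.
    move: spT T1; rewrite /spread /nwords.
    by case: x1 y1 => [] []; case: (T false false); case: (T false true);
      case: (T true false); case: (T true true); auto.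
  case=> cT; [have -> : bias d T = 2 by rewrite /bias cT
    | have -> : bias d T = 1 by rewrite /bias cT].
    apply: (strip_prefix (@solvable_all _) (p := [:: x1; y1]) _ uX X0 szw) => // s sX.
    have [x [y [r [-> Txy]]]] := pT _ sX.
    move: cT Txy T1; rewrite /nwords /= prefix0s.
    by case: x y x1 y1 => [] [] [] []; case: (T false false);
      case: (T false true); case: (T true false); case: (T true true).
  (* [T] has one word in each half, and [T x true] is its second bit in the half [x]. *)
  apply: (strip_two (g := fun x => T x true) (@solvable_all _) uX X0 szw) => // s sX.
  have [x [y [r [-> Txy]]]] := pT _ sX; exists x.
  move: spT cT Txy; rewrite /spread /nwords /= prefix0s eqxx.
  by case: x y => [] []; case: (T false false); case: (T false true);
    case: (T true false); case: (T true true).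
have [b [Tb Tnb]] : exists b, (T b false && T b true) /\
    (nwords T = 4%N \/ nwords T = 2%N /\ forall y, T (~~ b) y = false).
  move: nspT nT3; rewrite /spread /nwords.
  case E0: (T false false); case E1: (T false true);
  case E2: (T true false); case E3: (T true true) => //= _ _.
  - by exists true; rewrite E2 E3; auto.
  - by exists false; rewrite E0 E1; split=> //; right; split=> // -[].
  - by exists true; rewrite E2 E3; split=> //; right; split=> // -[].
case: Tnb => [cT|[cT Tnb]]; [have -> : bias d T = 0 by rewrite /bias cT
  | have -> : bias d T = 1 by rewrite /bias cT].
  apply: solved_mono (solvable_config uX X0 D) => s _; lra.
apply: (strip_prefix (@solvable_all _) (p := [:: b]) _ uX X0 szw) => // s sX.
have := inT sX; case: (w s) => [|x r] H.
  have [y Hy] := spreadP (~~ b) (spA s).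
  by have := H (app [:: ~~ b; y] (fun=> false)) Hy; rewrite /= Tnb.
have [z Hz] := spread_ne r (spA s).
have := H (app [:: x] z); rewrite /= eqxx prefix0s andbT => /(_ Hz).
by case: x b Tnb {Tb H Hz} => [] [] // ->.
Qed.

(** Let [g h] be the word missing from [T]. The grandchild [g (~~ h)] plays the node 01 of the
    second AIFV state and the half [~~ g] plays the node 1. A root symbol instead becomes a leaf at
    1, and the others, all below one grandchild, go under 01. *)
Lemma solved1_in : nwords T = 3%N -> solved1 X (cst w).
Proof.
move=> cT.
have [g [h [Tgh TE]]] : exists g h, T g h = false /\
    forall x y, T x y = ((x, y) != (g, h)).
  move: cT; rewrite /nwords.
  case E0: (T false false); case E1: (T false true);
  case E2: (T true false); case E3: (T true true) => //= _;
  [exists true, true|exists true, false|exists false, true|exists false, false];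
  by split=> // [] [] [].
have [/hasP[s sX /eqP ws]|noroot] := boolP (has (fun s => w s == [::]) X).
  have Agh : A s g h = false.
    apply/negP => Agh; have := inT sX (z := app [:: g; h] (fun=> false)).
    by rewrite ws /= Tgh; move/(_ Agh).
  have pX : perm_eq X (s :: rem s X) by exact: perm_to_rem.
  apply: (@solved1_perm (rem s X ++ [:: s])).
    by rewrite cats1 perm_sym (perm_trans pX) // perm_sym perm_rcons.
  have Y0 : rem s X != [::].
    by move/perm_size: pX X1 => ->; case: (rem s X).
  set Y := rem s X in Y0 *.
  have YP s' : s' \in Y -> s' \in X /\ s != s'.
    by rewrite mem_rem_uniq // inE => /andP[+ ->]; rewrite eq_sym.
  (* As soon as another symbol exists, [A s] has one word in the half [~~ g], and this value is the
     second bit it leaves free. *)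
  pose y0 := A s (~~ g) false.
  have other s' : s' \in Y -> A s (~~ g) y0 = false /\ prefix [:: ~~ g; y0] (w s').
    move=> /YP[s'X ss'].
    have [|||[ws' E]|[x [y [r [Ew Axy]]]]] := @root_other (A s) (w s') (A s') => //.
    - by move=> z Hz; apply: (D sX s'X ss'); rewrite ws.
    - have := inT s'X (z := app [:: g; h] (fun=> false)).
      by rewrite ws' /= E Agh Tgh => /(_ isT).
    - have [z Hz] := spread_ne r (spA s').
      have := inT s'X (z := app [:: x; y] z).
      rewrite Ew /= !eqxx TE => /(_ Hz) xy.
      move: (spA s) Axy Agh xy; rewrite prefix0s /y0 /spread !xpair_eqE.
      by case: x y g h {Tgh TE y0 Ew} => [] [] [] [] //=;
        case E1: (A s false false); case E2: (A s false true);
        case E3: (A s true false); case E4: (A s true true);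
        rewrite ?E1 ?E2 ?E3 ?E4.
  have [s1 s1Y] : exists s, s \in Y.
    by case: Y Y0 {YP other} => // s2 Y' _; exists s2; rewrite mem_head.
  have [Agy _] := other _ s1Y.
  apply: solved_pair.
    apply: (strip_prefix (@solvable_all _) (p := [:: ~~ g; y0])) => //.
    - exact: rem_uniq.
    - by move=> s' /YP[s'X _]; exact: szw.
    - by move=> s' /other[].
    - by apply: sub_disj D => s' /YP[].
  apply: solved_leaf; rewrite /cst ws /bias.
  have -> : nwords (A s) = 2%N; last by rewrite add0r subrr.
  move: (spA s) Agy Agh; rewrite /nwords /spread /y0.
  by case: g h {Tgh TE y0 other} => [] [] /=;
    case E1: (A s false false); case E2: (A s false true);
    case E3: (A s true false); case E4: (A s true true);
    rewrite ?E1 ?E2 ?E3 ?E4.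
pose hd s := head false (w s) == g.
have gh s : s \in X -> if hd s then prefix [:: g; ~~ h] (w s) else prefix [:: ~~ g] (w s).
  move=> sX; move/hasPn: noroot => /(_ s sX); move: (inT sX); rewrite /hd.
  case: (w s) => [|x [|y r]] //= inTs _.
    have [y1 Hy] := spreadP h (spA s).
    have := inTs (app [:: x; h; y1] (fun=> false)); rewrite /= eqxx TE => /(_ Hy).
    by rewrite xpair_eqE eqxx andbT; case: (x) (g) => [] [].
  have [z Hz] := spread_ne r (spA s).
  have := inTs (app [:: x; y] z); rewrite /= !eqxx TE => /(_ Hz).
  by rewrite xpair_eqE ?prefix0s; case: (x) (y) (g) (h) => [] [] [] [].
have pX : perm_eq (filter hd X ++ filter (predC hd) X) X by exact/permPl/perm_filterC.
have sol1 : filter hd X != [::] -> solved (filter hd X) (fun s => cst w s - 2).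
  move=> Y0; apply: (strip_prefix (@solvable_all _) (p := [:: g; ~~ h])) => //.
  - exact: filter_uniq.
  - by move=> s /filter_subset; exact: szw.
  - by move=> s; rewrite mem_filter => /andP[hs /gh]; rewrite hs.
  - by apply: sub_disj D; exact: filter_subset.
have sol2 : filter (predC hd) X != [::] ->
    solved (filter (predC hd) X) (fun s => cst w s - 1).
  move=> Y0; apply: (strip_prefix (@solvable_all _) (p := [:: ~~ g])) => //.
  - exact: filter_uniq.
  - by move=> s /filter_subset; exact: szw.
  - by move=> s; rewrite mem_filter => /andP[/= /negbTE hs /gh]; rewrite hs.
  - by apply: sub_disj D; exact: filter_subset.
have [Y1|Y1] := eqVneq (filter hd X) [::]; last first.
  have [Y2|Y2] := eqVneq (filter (predC hd) X) [::]; last first.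
    by apply: solved1_perm pX _; apply: solved_pair; [exact: sol1|exact: sol2].
  apply: solved_solved1 => //; rewrite Y2 cats0 in pX.
  by apply: solved_perm pX _; apply: solved_mono (sol1 Y1) => s _; lra.
rewrite Y1 in pX; have [Y2|Y2] := eqVneq (filter (predC hd) X) [::].
  by move: pX X0; rewrite Y2 perm_sym => /perm_nilP ->.
by apply: solved_solved1 => //; apply: solved_perm pX _; exact: sol2.
Qed.

End Inside.

End Configurations.
End Costs.

(** * Finite enumeration of trees and the choice of [d] *)

Section TreeEq.
Variable S : choiceType.

Fixpoint tree_enc (t : tree S) : GenTree.tree S :=
  match t with
  | Leaf s => GenTree.Leaf s
  | Br u v => GenTree.Node 0 [:: tree_enc u; tree_enc v]
  | Hole s u => GenTree.Node 1 [:: GenTree.Leaf s; tree_enc u]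
  end.

Fixpoint tree_dec (g : GenTree.tree S) : option (tree S) :=
  match g with
  | GenTree.Leaf s => Some (Leaf s)
  | GenTree.Node 0 [:: g1; g2] =>
      if (tree_dec g1, tree_dec g2) is (Some u, Some v) then Some (Br u v)
      else None
  | GenTree.Node 1 [:: GenTree.Leaf s; g1] => omap (Hole s) (tree_dec g1)
  | _ => None
  end.

Lemma tree_encK : pcancel tree_enc tree_dec.
Proof. by elim=> //= [u -> v ->|s u ->]. Qed.

HB.instance Definition _ := Choice.copy (tree S) (pcan_type tree_encK).
End TreeEq.

Fixpoint trees (S : finType) (n : nat) : seq (tree S) :=
  if n is n'.+1 then
    [seq Leaf s | s <- enum S] ++
    [seq Br u v | u <- trees S n', v <- trees S n'] ++
    [seq Hole s u | s <- enum S, u <- trees S n']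
  else [::].

Lemma size_syms_gt0 (S : Type) (t : tree S) : (0 < size (syms t))%N.
Proof. by elim: t => //= u IHu v IHv; rewrite size_cat ltn_addr. Qed.

(** Each child has fewer symbols than its parent, so the number of symbols bounds the depth. The
    minima over trees thus range over finite lists. *)
Lemma mem_trees (S : finType) n (t : tree S) :
  (size (syms t) <= n)%N -> t \in trees S n.
Proof.
elim: n t => [|n IH] t.
  by rewrite leqNgt size_syms_gt0.
case: t => [s|u v|s u] /=; rewrite !mem_cat.
- by rewrite map_f // mem_enum.
- rewrite size_cat => H; rewrite allpairs_f ?orbT //; apply: IH.
    by rewrite -ltnS (leq_trans _ H) // -addn1 leq_add2l size_syms_gt0.
  by rewrite -ltnS (leq_trans _ H) // -add1n leq_add2r size_syms_gt0.
- by rewrite ltnS => H; rewrite allpairs_f ?orbT ?mem_enum //; exact: IH.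
Qed.

(** Informative rather than a bare existential, so that a minimiser can be chosen as a function of a
    parameter. *)
Lemma seq_min (R : realFieldType) (T : eqType) (f : T -> R) (l : seq T) :
  l != [::] -> {x | x \in l & {in l, forall y, f x <= f y}}.
Proof.
elim: l => // a l IH _; have [l0|/IH[x xl xP]] := eqVneq l [::].
  by exists a; rewrite l0 ?mem_head // => y; rewrite inE => /eqP ->.
have [ax|xa] := leP (f a) (f x).
  exists a; first exact: mem_head.
  by move=> y; rewrite inE => /orP[/eqP ->//|/xP]; exact: le_trans.
exists x; first by rewrite inE xl orbT.
by move=> y; rewrite inE => /orP[/eqP ->|/xP//]; exact: ltW.
Qed.

(* [a_i + d p_i] are the costs of the tables of state i at bias d.  Since
   [p1 < 1], each [a1 x + d p1 x - (a0 y + d p0 y + d)] decreases in d with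
   root [r x y], so the common minimisation is solved by [d = min_x max_y r x y]. *)
Lemma minmax_bias (R : realFieldType) (T0 T1 : eqType) (l0 : seq T0) (l1 : seq T1)
    (a0 p0 : T0 -> R) (a1 p1 : T1 -> R) :
  l0 != [::] -> l1 != [::] ->
  {in l0, forall y, 0 <= p0 y} -> {in l1, forall x, p1 x < 1} ->
  {in l1, forall x, exists2 y, y \in l0 & a0 y <= a1 x} ->
  exists d x0 x1, [/\ 0 <= d, x0 \in l0, x1 \in l1,
    {in l0, forall y, a0 x0 + d * p0 x0 <= a0 y + d * p0 y} &
    {in l1, forall x, a1 x1 + d * p1 x1 <= a1 x + d * p1 x} /\
    a1 x1 + d * p1 x1 = a0 x0 + d * p0 x0 + d].
Proof.
move=> l00 l10 p0P p1P a01.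
pose den x y := 1 + p0 y - p1 x; pose r x y := (a1 x - a0 y) / den x y.
have den_gt0 x y : x \in l1 -> y \in l0 -> 0 < den x y.
  by move=> /p1P ? /p0P ?; rewrite /den; lra.
(* [m x] maximises [r x], as a minimiser of its opposite. *)
pose m x := s2val (seq_min (fun y => - r x y) l00).
have ml x : m x \in l0 by exact: (s2valP (seq_min _ l00)).
have mP x y : y \in l0 -> r x y <= r x (m x).
  by move=> yl; rewrite -lerN2; exact: (s2valP' (seq_min (fun y => - r x y) l00) _ yl).
have [x1 x1l x1P] := seq_min (fun x => r x (m x)) l10.
pose d := r x1 (m x1); exists d, (m x1), x1.
have rle x y : x \in l1 -> y \in l0 -> (r x y <= d) =
    (a1 x + d * p1 x <= a0 y + d * p0 y + d).
  move=> xl yl; rewrite /r ler_pdivrMr ?den_gt0 // /den.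
  by apply/idP/idP; lra.
have rge x y : x \in l1 -> y \in l0 -> (d <= r x y) =
    (a0 y + d * p0 y + d <= a1 x + d * p1 x).
  move=> xl yl; rewrite /r ler_pdivlMr ?den_gt0 // /den.
  by apply/idP/idP; lra.
have eqd : a1 x1 + d * p1 x1 = a0 (m x1) + d * p0 (m x1) + d.
  by apply/eqP; rewrite eq_le -rle // -rge // /d lexx.
have P0 : {in l0, forall y, a0 (m x1) + d * p0 (m x1) <= a0 y + d * p0 y}.
  by move=> y yl; have := mP x1 y yl; rewrite -/d rle // eqd; lra.
split=> //; last first.
  split=> // x xl; have := x1P x xl; rewrite -/d rge // eqd.
  by have := P0 _ (ml x); lra.
(* [d] is nonnegative because it is at least [r x1 y] for the [y] of [a01], whose numerator is
   nonnegative. *)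
have [y yl ay] := a01 _ x1l; apply: le_trans (mP x1 y yl).
by apply: divr_ge0; [rewrite subr_ge0 | exact/ltW/den_gt0].
Qed.

(** * Codewords read off a tree *)

Section Codewords.
Variable S : eqType.
Implicit Types (t u v : tree S) (s : S) (b : seq bool).

(** A symbol absent from the tree gets a meaningless word, hence the membership hypotheses in the
    lemmas on prefixes. *)
Fixpoint cw t s : seq bool :=
  match t with
  | Leaf _ => [::]
  | Br u v => if s \in syms u then false :: cw u s else true :: cw v s
  | Hole s0 u => if s == s0 then [::] else [:: false, false & cw u s]
  end.

Fixpoint inner t s : bool :=
  match t with
  | Leaf _ => false
  | Br u v => if s \in syms u then inner u s else inner v s
  | Hole s0 u => (s == s0) || inner u s
  end.

Definition cw1 u v s : seq bool :=
  if s \in syms u then [:: false, true & cw u s] else true :: cw v s.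

Lemma cat_uniq_notin u v s : uniq (syms u ++ syms v) -> s \in syms v ->
  s \in syms u = false.
Proof.
rewrite cat_uniq => /and3P[_ /hasPn H _] sv; apply/negbTE.
by apply: contraL (sv) => su; apply: contraL su => /H.
Qed.

Lemma syms_ne t : exists s, s \in syms t.
Proof.
by have := size_syms_gt0 t; case: (syms t) => // s X _; exists s; rewrite mem_head.
Qed.

(** Two distinct symbols are nested only through a [Hole], which hangs its whole subtree at 00. *)
Lemma cw_pre t s s' : uniq (syms t) -> s \in syms t -> s' \in syms t ->
  prefix (cw t s) (cw t s') ->
  s = s' \/ inner t s /\ prefix (cw t s ++ [:: false; false]) (cw t s').
Proof.
elim: t s s' => [s0|u IHu v IHv|s0 u IHu] s s' /=.
- by rewrite !inE => _ /eqP -> /eqP ->; left.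
- move=> U; have uu : uniq (syms u) by move: U; rewrite cat_uniq => /and3P[].
  have uv : uniq (syms v) by move: U; rewrite cat_uniq => /and3P[].
  rewrite !mem_cat.
  case: ifP => [su|nsu]; case: ifP => [su'|nsu'] //= sv sv'.
    exact: IHu.
  exact: IHv.
- move=> /andP[ns0 uu]; rewrite !inE.
  case: eqVneq => [-> _|ss0 /= su]; case: eqVneq => [-> _|ss0' /= su'] //=.
  + by left.
  + by right; rewrite prefix0s.
  + exact: IHu.
Qed.

Lemma inner_ext t s : uniq (syms t) -> s \in syms t -> inner t s ->
  exists2 s', s' \in syms t & prefix (cw t s ++ [:: false; false]) (cw t s').
Proof.
elim: t s => [s0|u IHu v IHv|s0 u IHu] s //=.
- move=> U; have uu : uniq (syms u) by move: U; rewrite cat_uniq => /and3P[].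
  have uv : uniq (syms v) by move: U; rewrite cat_uniq => /and3P[].
  rewrite mem_cat; case: ifP => [su _|nsu /= sv].
    move=> /(IHu _ uu su)[s' su' H]; exists s'; first by rewrite mem_cat su'.
    by rewrite su'.
  move=> /(IHv _ uv sv)[s' sv' H]; exists s'; first by rewrite mem_cat sv' orbT.
  by rewrite (cat_uniq_notin U sv').
- move=> /andP[ns0 uu]; rewrite inE; case: eqVneq => [-> _ _|ss0 /= su].
    have [s' su'] := syms_ne u; exists s'; first by rewrite inE su' orbT.
    by case: eqVneq su' ns0 => [-> ->//|_ _ _]; rewrite /= prefix0s.
  move=> /(IHu _ uu su)[s' su' H]; exists s'; first by rewrite inE su' orbT.
  by case: eqVneq su' ns0 => [-> ->|].
Qed.

(* Every inner node has two children, apart from the nodes [cw t s] and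
   [cw t s ++ [:: false]] forced by a symbol s sitting at an inner node. *)
Lemma cw_branch t s b : uniq (syms t) -> s \in syms t ->
  prefix b (cw t s) -> b != cw t s ->
  (exists2 s0, s0 \in syms t & b = cw t s0 \/ b = cw t s0 ++ [:: false]) \/
  (exists s1 s2, [/\ s1 \in syms t, s2 \in syms t,
    prefix (b ++ [:: false]) (cw t s1) & prefix (b ++ [:: true]) (cw t s2)]).
Proof.
elim: t s b => [s0|u IHu v IHv|s0 u IHu] s b /=.
- by case: b.
- move=> U; have uu : uniq (syms u) by move: U; rewrite cat_uniq => /and3P[].
  have uv : uniq (syms v) by move: U; rewrite cat_uniq => /and3P[].
  have inu s' : s' \in syms u -> s' \in syms u ++ syms v by rewrite mem_cat => ->.
  have inv s' : s' \in syms v -> s' \in syms u ++ syms v.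
    by rewrite mem_cat => ->; rewrite orbT.
  have niv s' := @cat_uniq_notin u v s' U.
  case: b => [|x b].
    move=> _ _ _; right; have [s1 s1u] := syms_ne u; have [s2 s2v] := syms_ne v.
    exists s1, s2; split; [exact: inu|exact: inv|rewrite s1u|rewrite niv //];
      by rewrite /= prefix0s.
  rewrite mem_cat; case: ifP => [su _|nsu /= sv] /= /andP[/eqP ->] pb;
    rewrite eqseq_cons eqxx /= => nb.
    have [[s' s'u Hs']|[s1 [s2 [s1u s2u H1 H2]]]] := IHu _ _ uu su pb nb.
      by left; exists s'; rewrite ?inu // s'u; case: Hs' => ->; auto.
    by right; exists s1, s2; split; rewrite ?inu ?s1u ?s2u.
  have [[s' s'v Hs']|[s1 [s2 [s1v s2v H1 H2]]]] := IHv _ _ uv sv pb nb.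
    by left; exists s'; rewrite ?inv // niv //; case: Hs' => ->; auto.
  by right; exists s1, s2; split; rewrite ?inv ?niv.
- move=> /andP[ns0 uu]; rewrite inE.
  have nes s' : s' \in syms u -> s' == s0 = false.
    by case: eqVneq ns0 => // -> /negbTE ->.
  have ins s' : s' \in syms u -> s' \in s0 :: syms u by rewrite inE => ->; rewrite orbT.
  case: eqVneq => [_ _|ss0 /= su]; first by case: b.
  case: b => [|x [|y b]].
  + by left; exists s0; rewrite ?mem_head // eqxx; left.
  + rewrite /= => /andP[/eqP -> _] _.
    by left; exists s0; rewrite ?mem_head // eqxx; right.
  + rewrite /= => /and3P[/eqP -> /eqP ->] pb; rewrite !eqseq_cons !eqxx /= => nb.
    have [[s' s'u Hs']|[s1 [s2 [s1u s2u H1 H2]]]] := IHu _ _ uu su pb nb.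
      by left; exists s'; rewrite ?ins // nes //; case: Hs' => ->; auto.
    by right; exists s1, s2; split; rewrite ?ins ?nes.
Qed.

Section Sums.
Variables (R : realFieldType) (mu : S -> R).

Lemma cw_len t : uniq (syms t) ->
  \sum_(s <- syms t) mu s * (size (cw t s))%:R = len mu t.
Proof.
have shift (X : seq S) k (f g : S -> seq bool) :
    {in X, forall s, size (f s) = (k + size (g s))%N} ->
    \sum_(s <- X) mu s * (size (f s))%:R =
    \sum_(s <- X) mu s * (size (g s))%:R + k%:R * wt mu X.
  move=> fg; rewrite /wt mulr_sumr -big_split /= big_seq [RHS]big_seq.
  by apply: eq_bigr => s /fg ->; rewrite natrD; ring.
elim: t => [s0|u IHu v IHv|s0 u IHu] /=.
- by rewrite big_seq1 mulr0.
- move=> U; have uu : uniq (syms u) by move: U; rewrite cat_uniq => /and3P[].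
  have uv : uniq (syms v) by move: U; rewrite cat_uniq => /and3P[].
  rewrite big_cat /= (shift (syms u) 1%N _ (cw u)); last by move=> s /= ->.
  rewrite (shift (syms v) 1%N _ (cw v)); last by move=> s sv; rewrite (cat_uniq_notin U sv).
  rewrite IHu // IHv //; ring.
- move=> /andP[ns0 uu]; rewrite big_cons eqxx mulr0 add0r.
  rewrite (shift (syms u) 2%N _ (cw u)) ?IHu // => s su.
  by case: eqVneq su ns0 => // -> ->.
Qed.

(** The table is that of [Br u v] with one more bit on each codeword coming from [u]. *)
Lemma cw1_len u v : uniq (syms u ++ syms v) ->
  \sum_(s <- syms u ++ syms v) mu s * (size (cw1 u v s))%:R = len1 mu u v.
Proof.
move=> U; have <- : len mu (Br u v) + wt mu (syms u) = len1 mu u v.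
  by rewrite /len1 /=; ring.
rewrite -(cw_len (t := Br u v)) //= !big_cat /= addrAC; congr (_ + _).
  rewrite /wt -big_split /= big_seq [RHS]big_seq; apply: eq_bigr => s su.
  by rewrite /cw1 su /= -[_.+2]addn1 natrD mulrDr mulr1.
rewrite big_seq [RHS]big_seq; apply: eq_bigr => s sv; have E := cat_uniq_notin U sv.
by rewrite /cw1 E.
Qed.

Lemma inner_hol t : uniq (syms t) ->
  \sum_(s <- syms t) mu s * (inner t s)%:R = hol mu t.
Proof.
have same (X : seq S) (f g : S -> bool) : {in X, f =1 g} ->
    \sum_(s <- X) mu s * (f s)%:R = \sum_(s <- X) mu s * (g s)%:R.
  by move=> fg; rewrite big_seq [RHS]big_seq; apply: eq_bigr => s /fg ->.
elim: t => [s0|u IHu v IHv|s0 u IHu] /=.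
- by rewrite big_seq1 mulr0.
- move=> U; have uu : uniq (syms u) by move: U; rewrite cat_uniq => /and3P[].
  have uv : uniq (syms v) by move: U; rewrite cat_uniq => /and3P[].
  rewrite big_cat /= -IHu // -IHv //; congr (_ + _); apply: same => s.
    by move=> ->.
  by move=> sv; rewrite (cat_uniq_notin U sv).
- move=> /andP[ns0 uu]; rewrite big_cons eqxx mulr1 -IHu //; congr (_ + _).
  by apply: same => s su; case: eqVneq su ns0 => // -> ->.
Qed.

End Sums.
End Codewords.

(** * Lookahead sets of a code-tuple *)

Lemma cyl_mkseq w A z : cyl w A z ->
  exists x y, A x y /\ w ++ [:: x; y] = mkseq z (size w).+2.
Proof.
have mkseqS' (f : nat -> bool) n : mkseq f n.+1 = f 0%N :: mkseq (fun k => f k.+1) n.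
  by rewrite /mkseq /= -[1%N]addn0 iotaDl -map_comp.
elim: w z => [|b w IH] z /=; first by exists (z 0%N), (z 1%N).
by case/andP=> /eqP <- /IH[x [y [Axy E]]]; exists x, y; rewrite mkseqS' E.
Qed.

Lemma prefix_mkseq (T : eqType) (z : nat -> T) m n : (m <= n)%N ->
  prefix (mkseq z m) (mkseq z n).
Proof.
move=> mn; rewrite prefixE size_mkseq /mkseq -map_take take_iota.
by rewrite (minn_idPl mn).
Qed.

Lemma sum_over_enum (R : realFieldType) (S : finType) (g : S -> R) :
  \sum_(s <- enum S) g s = \sum_s g s.
Proof. by rewrite big_enum. Qed.

Section CodeTupleTypes.
Variables (S : finType) (F : codeTuple S).

Lemma fstar_cat (i : 'I_(ct_n F)) x y :
  fstar i (x ++ y) = fstar i x ++ fstar (taustar i x) y.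
Proof. by elim: x i => //= s x IH i; rewrite IH catA. Qed.

Lemma fstar_cons (i : 'I_(ct_n F)) s x :
  fstar i (s :: x) = ct_f i s ++ fstar (ct_tau i s) x.
Proof. by []. Qed.

(** [Pk] quantifies over all messages, so its truth value is taken classically to obtain a boolean
    set for [cyl]. *)
Definition lookahead (i : 'I_(ct_n F)) (x y : bool) : bool :=
  `[< Pk 2 i [::] [:: x; y] >].

(** Extendability yields one bit; if the code stops there, extendability at the state reached yields
    the second. *)
Lemma lookahead_ne : extendable F -> forall i, exists x y, lookahead i x y.
Proof.
move=> ext i.
have [c [sc [x1 [xs [[r1 E1] _]]]]] := ext i.
have [c' [sc' [x1' [xs' [[r2 E2] _]]]]] := ext (taustar i (x1 :: xs)).
case: c sc E1 => // a [] // _ E1; case: c' sc' E2 => // a' [] // _ E2.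
have E : exists x y r, fstar i (x1 :: (xs ++ x1' :: xs')) = [:: x, y & r].
  rewrite -cat_cons fstar_cat E1 E2; case: r1 {E1} => [|b r1].
    by exists a, a', r2.
  by exists a, b, (r1 ++ [:: a' & r2]).
have [x [y [r Er]]] := E; exists x, y; apply/asboolP; split=> //.
exists x1, (xs ++ x1' :: xs'); split; last by exists (ct_f i x1).
by exists r.
Qed.

Lemma lookahead_in (i : 'I_(ct_n F)) s z :
  cyl (ct_f i s) (lookahead (ct_tau i s)) z -> lookahead i (z 0%N) (z 1%N).
Proof.
move=> /cyl_mkseq[x [y [/asboolP[_ [x1 [xs [[r E] _]]]] Em]]].
apply/asboolP; split=> //; exists s, (x1 :: xs); split; last by exists (ct_f i s).
apply/prefixP; apply: (@prefix_trans _ (ct_f i s ++ [:: x; y])).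
  by rewrite Em (@prefix_mkseq _ z 2).
by apply/prefixP; exists r; rewrite fstar_cons E /= -catA.
Qed.

(** By symmetry let the codeword of [s] be the shorter one; a common stream makes it a prefix of the
    other. Equal codewords contradict the second clause of decodability, a proper prefix the
    first. *)
Lemma lookahead_disj (i : 'I_(ct_n F)) s s' : two_bit_delay_decodable F ->
  s != s' -> forall z, cyl (ct_f i s) (lookahead (ct_tau i s)) z ->
  ~~ cyl (ct_f i s') (lookahead (ct_tau i s')) z.
Proof.
case=> dec1 dec2.
wlog le_ss' : s s' / (size (ct_f i s) <= size (ct_f i s'))%N.
  move=> W ss' z Hz; have [?|lt] := leqP (size (ct_f i s)) (size (ct_f i s')).
    exact: W Hz.
  by apply: contraL Hz; apply: W; rewrite 1?ltnW // eq_sym.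
move=> /eqP ss' z /cyl_mkseq[x [y [/asboolP Ls Em]]]; apply/negP.
move=> /cyl_mkseq[x' [y' [/asboolP Ls' Em']]].
have pf : prefix (ct_f i s) (ct_f i s').
  have : prefix (ct_f i s) (mkseq z (size (ct_f i s'))).
    apply: (@prefix_trans _ (mkseq z (size (ct_f i s)))); last exact: prefix_mkseq.
    have /(congr1 (take (size (ct_f i s)))) := Em.
    rewrite take_size_cat // => {1}->.
    rewrite /mkseq -map_take take_iota (minn_idPl _) ?prefix_refl //.
    by rewrite -addn2 leq_addr.
  have /(congr1 (take (size (ct_f i s')))) := Em'.
  rewrite take_size_cat // /mkseq -map_take take_iota (minn_idPl _) => [<- //|].
  by rewrite -addn2 leq_addr.
have pfx : prefix (ct_f i s ++ [:: x; y]) (ct_f i s' ++ [:: x'; y']).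
  by rewrite Em Em' prefix_mkseq.
have [E|ne] := eqVneq (ct_f i s) (ct_f i s').
  move: pfx; rewrite E prefix_catr // eqxx /= => /and3P[/eqP Ex /eqP Ey _].
  by apply: (dec2 i s s' ss' E [:: x; y]); rewrite {2}Ex {2}Ey.
apply: (dec1 i s [:: x; y]); split=> //; split=> //.
have [_ [x1 [xs [[r Er] _]]]] := Ls'.
exists s', (x1 :: xs); split; last by split; [exact/prefixP|exact/eqP].
apply/prefixP; apply: prefix_trans pfx _; apply/prefixP; exists r.
by rewrite fstar_cons Er /= -catA.
Qed.

End CodeTupleTypes.

(** * The Bellman inequality for an arbitrary table *)

Section LowerBound.
Variables (R : realType) (S : finType) (mu : S -> R).
Hypotheses (S2 : (2 <= #|S|)%N) (mu_gt0 : forall s, 0 < mu s)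
  (mu1 : \sum_s mu s = 1).

Lemma wt_enum : wt mu (enum S) = 1.
Proof. by rewrite /wt sum_over_enum. Qed.

Section Table.
Variables (d Ls : R).
Hypotheses (d_ge0 : 0 <= d)
  (opt0 : forall t, perm_eq (syms t) (enum S) -> Ls <= len mu t + d * hol mu t)
  (opt1 : forall u v, perm_eq (syms u ++ syms v) (enum S) ->
    Ls + d <= len1 mu u v + d * (hol mu u + hol mu v)).

(** The cylinders, made spread by [normalize], form a packing inside [lookahead i]. Three words
    there lead to a table of the second AIFV state, any other number to one of the first. *)
Lemma table_bound (F : codeTuple S) (i : 'I_(ct_n F)) :
  extendable F -> two_bit_delay_decodable F ->
  Ls + bias d (lookahead i) <=
    \sum_s mu s * ((size (ct_f i s))%:R + bias d (lookahead (ct_tau i s))).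
Proof.
move=> ext dec; pose c s := (size (ct_f i s))%:R + bias d (lookahead (ct_tau i s)).
rewrite -[leRHS]/(\sum_s mu s * c s).
have /fin_all_exists[wA wAP] : forall s, exists wA : seq bool * (bool -> bool -> bool),
    [/\ spread wA.2,
     forall z, cyl wA.1 wA.2 z = cyl (ct_f i s) (lookahead (ct_tau i s)) z
     & (size wA.1)%:R + bias d wA.2 = c s].
  move=> s; have [w [A [sA cA bA]]] :=
    normalize d (ct_f i s) (lookahead_ne ext (ct_tau i s)).
  by exists (w, A).
pose w s := (wA s).1; pose A s := (wA s).2.
have spA s : spread (A s) by case: (wAP s).
have D : disj A (enum S) w.
  move=> s s' _ _ ss' z; case: (wAP s) => _ -> _; case: (wAP s') => _ -> _.
  exact: lookahead_disj.
have inT : {in enum S, forall s, forall z, cyl (w s) (A s) z ->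
    lookahead i (z 0%N) (z 1%N)}.
  by move=> s _ z; case: (wAP s) => _ -> _; exact: lookahead_in.
have uS : uniq (enum S) by exact: enum_uniq.
have S1 : (1 < size (enum S))%N by rewrite -cardE.
have sumE (k : R) : \sum_(s <- enum S) mu s * (cst d A w s - k) =
    \sum_s mu s * c s - k.
  rewrite sum_shift wt_enum mulr1 sum_over_enum; congr (_ - _).
  by apply: eq_bigr => s _; rewrite /cst; case: (wAP s) => _ _ ->.
have [T3|/eqP T3] := eqVneq (nwords (lookahead i)) 3%N.
  have [u [v [pt ct]]] := solved1_in mu_gt0 d_ge0 spA inT uS S1 D T3.
  have /(le_trans (opt1 pt)) := ct.
  have := sumE 0; rewrite subr0; under eq_bigr do rewrite subr0; move=> ->.
  by rewrite /bias T3.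
have [t [pt ct]] := solved_in mu_gt0 d_ge0 spA inT uS S1 D T3.
by have := le_trans (opt0 pt) ct; rewrite sumE; lra.
Qed.

End Table.

(** * Stationary vectors *)

Section Stationary.
Variable F : codeTuple S.
Implicit Type pi : 'rV[R]_(ct_n F).

Lemma Qmat_ge0 i j : 0 <= Qmat mu F i j.
Proof. by rewrite mxE sumr_ge0 // => s _; exact: ltW. Qed.

Lemma Qmat_sum i : \sum_j Qmat mu F i j = 1.
Proof.
rewrite -mu1 (partition_big (ct_tau i) predT) //=.
by apply: eq_bigr => j _; rewrite mxE.
Qed.

(** Invariance of [pi] under one step; it cancels the biases when the table inequalities are
    summed. *)
Lemma stationary_sum pi (g : 'I_(ct_n F) -> R) : stationary mu pi ->
  \sum_i pi 0 i * (\sum_s mu s * g (ct_tau i s)) = \sum_i pi 0 i * g i.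
Proof.
case=> piQ _; rewrite -[in RHS]piQ.
under [RHS]eq_bigr => j _ do rewrite mxE mulr_suml.
rewrite exchange_big /=; apply: eq_bigr => i _.
under [RHS]eq_bigr do rewrite -mulrA.
rewrite -mulr_sumr; congr (_ * _).
rewrite (partition_big (ct_tau i) predT) //=; apply: eq_bigr => j _.
rewrite mxE mulr_suml; apply: eq_big => // s /eqP ->; by [].
Qed.

(* |pi| is again stationary up to normalisation, so it is pi by uniqueness. *)
Lemma stationary_ge0 pi : regular mu F -> stationary mu pi -> forall i, 0 <= pi 0 i.
Proof.
move=> [pi0 [_ uni]] st; have [piQ pi1] := st.
pose q : 'rV[R]_(ct_n F) := \row_i `|pi 0 i|.
have le_q j : q 0 j <= (q *m Qmat mu F) 0 j.
  rewrite [q 0 j]mxE -{1}piQ [(pi *m _) 0 j]mxE [leRHS]mxE.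
  apply: le_trans (ler_norm_sum _ _ _) _; apply: ler_sum => i _.
  by rewrite normrM [q 0 i]mxE (ger0_norm (Qmat_ge0 _ _)).
have sumq : \sum_j (q *m Qmat mu F) 0 j = \sum_j q 0 j.
  under eq_bigr do rewrite mxE.
  rewrite exchange_big /=; apply: eq_bigr => i _.
  by rewrite -mulr_sumr Qmat_sum mulr1.
(* [q *m Qmat mu F] dominates [q] entrywise by the triangle inequality and has the same total, so
   all differences vanish. *)
have qQ : q *m Qmat mu F = q.
  apply/rowP => j; apply/eqP; rewrite -subr_eq0.
  have /psumr_eq0P H : \sum_j ((q *m Qmat mu F) 0 j - q 0 j) = 0.
    by rewrite sumrB sumq subrr.
  by rewrite H // => k _; rewrite subr_ge0.
pose c := \sum_j q 0 j.
have c_ge1 : 1 <= c.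
  rewrite -pi1; apply: le_trans (ler_norm _) _.
  by apply: le_trans (ler_norm_sum _ _ _) _; apply: ler_sum => i _; rewrite mxE.
have c_gt0 : 0 < c by exact: lt_le_trans c_ge1.
have stq : stationary mu (c^-1 *: q).
  split; first by rewrite -scalemxAl qQ.
  under eq_bigr do rewrite mxE.
  by rewrite -mulr_sumr mulVf // gt_eqF.
move=> i; rewrite -(uni _ st) (uni _ stq) !mxE.
by rewrite mulr_ge0 // invr_ge0 ltW.
Qed.

End Stationary.

End LowerBound.

Lemma pre_prefix x y : pre x y -> prefix x y.
Proof. by move=> H; apply/prefixP. Qed.

(** * AIFV code-tuples from two abstract tables *)

Section TwoTables.
Variables (S : finType) (f : bool -> S -> seq bool) (inn : bool -> S -> bool).

(** The boolean [true] names the second state. A symbol flagged by [inn] leads there, since 00 after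
    its codeword is reserved for longer codewords. *)
Definition two_tables : codeTuple S :=
  @CodeTuple S 2 isT (fun i s => f (val i == 1%N) s)
    (fun i s => if inn (val i == 1%N) s then ord_max else ord0).

Hypotheses (S2 : (2 <= #|S|)%N)
  (f_pre : forall b s s', prefix (f b s) (f b s') ->
    s = s' \/ inn b s /\ prefix (f b s ++ [:: false; false]) (f b s'))
  (f_ext : forall b s, inn b s ->
    exists s', prefix (f b s ++ [:: false; false]) (f b s'))
  (f_hd : forall s, (exists r, f true s = [:: false, true & r]) \/
    exists r, f true s = true :: r)
  (f_branch : forall b s p, prefix p (f b s) -> p != f b s ->
    [\/ exists s0, p = f b s0 \/ p = f b s0 ++ [:: false],
        exists s1 s2, prefix (p ++ [:: false]) (f b s1) /\
          prefix (p ++ [:: true]) (f b s2)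
      | b /\ p = [:: false]]).

Let F := two_tables.
Let st (i : 'I_(ct_n F)) : bool := val i == 1%N.

Lemma two_tables_inj b : injective (f b).
Proof.
move=> s s' E; have := @f_pre b s s'; rewrite E prefix_refl.
case=> // -[_ /prefixP[r]]; rewrite -catA => /(congr1 size) /eqP.
by rewrite size_cat -[X in X == _]addn0 eqn_add2l.
Qed.

(** Strictness of the prefix places the bit [x] inside the first codeword, so later symbols have no
    influence. *)
Lemma Pbark1P (i : 'I_(ct_n F)) b x : Pbark 1 i b [:: x] ->
  exists s, prefix (b ++ [:: x]) (f (st i) s).
Proof.
case=> _ [s [xs [[r E] [[r' Er'] ne]]]]; exists s.
have {}E : f (st i) s ++ fstar (ct_tau i s) xs = (b ++ [:: x]) ++ r by [].
rewrite -[ct_f i s]/(f (st i) s) in Er' ne.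
move: E; rewrite Er' -!catA => /eqP; rewrite eqseq_cat // eqxx /=.
case: r' Er' => [Er'|y r' Er']; first by rewrite cats0 in Er'; case: ne.
by rewrite /= eqseq_cons => /andP[/eqP -> _]; apply/prefixP; exists r'; rewrite -catA.
Qed.

Lemma Pbark1I (i : 'I_(ct_n F)) b x s : prefix (b ++ [:: x]) (f (st i) s) ->
  Pbark 1 i b [:: x].
Proof.
move=> /prefixP[r E]; split=> //; exists s, [::]; split.
  by exists r; rewrite /= cats0.
have {}E : ct_f i s = b ++ [:: x] ++ r by rewrite catA.
split; first by exists ([:: x] ++ r).
rewrite E => /(congr1 size) /eqP.
by rewrite size_cat -[X in X == _]addn0 eqn_add2l.
Qed.

Lemma Pbark0E (i : 'I_(ct_n F)) s :
  (exists c, Pbark 0 i (ct_f i s) c) <-> inn (st i) s.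
Proof.
split.
  case=> c [/size0nil -> [s' [xs [_ [pf ne]]]]].
  have [E|[]//] := @f_pre (st i) s s' (pre_prefix pf).
  by case: ne; rewrite E.
move=> /f_ext[s' /prefixP[r E]]; exists [::]; split=> //; exists s', [::].
have {}E : ct_f i s' = ct_f i s ++ [:: false, false & r].
  by rewrite -[LHS]/(f (st i) s') E -catA.
split; first by exists [:: false, false & r]; rewrite /= !cats0.
split; first by exists [:: false, false & r].
rewrite E => /(congr1 size) /eqP.
by rewrite size_cat -[X in X == _]addn0 eqn_add2l.
Qed.

Lemma f_spre b s s' x r : f b s' = f b s ++ x :: r ->
  inn b s /\ prefix [:: false; false] (x :: r).
Proof.
move=> E; have [ss'|[-> pf]] := @f_pre b s s' (pre_prefix (ex_intro _ _ E)).
  move/(congr1 size)/eqP: E.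
  by rewrite ss' size_cat -[X in X == _]addn0 eqn_add2l.
by split=> //; move: pf; rewrite E prefix_catr // eqxx.
Qed.

Lemma two_tables_extendable : extendable F.
Proof.
move=> i.
have [s ns] : exists s, f (st i) s <> [::].
  move: S2; rewrite cardE; case E: (enum S) (enum_uniq S) => [|a [|b l]] //=.
  rewrite inE negb_or => /andP[/andP[ab _] _] _.
  case Ea: (f (st i) a) => [|x r]; last by exists a; rewrite Ea.
  exists b => Eb; move/eqP: ab; apply; apply: (@two_tables_inj (st i)).
  by rewrite Ea Eb.
case Es: (f (st i) s) ns => [|x r] // _.
exists [:: x]; split=> //; exists s, [::]; split; last by exists (ct_f i s).
by exists r; rewrite /= cats0; exact: Es.
Qed.

(** A proper extension of [f b s] continues with 00 and makes [s] inner, so the next state is the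
    second, whose codewords start with 01 or 1. The clause on equal codewords is vacuous by
    injectivity. *)
Lemma two_tables_decodable : two_bit_delay_decodable F.
Proof.
split=> [i s c|i s s' ss' E c]; last first.
  by case: ss'; exact: (@two_tables_inj (st i)).
case=> -[sc [x1 [xs [[r E] _]]]] [_ [s' [xs' [[r' E'] [[d Ed] ne]]]]].
have {}Ed : f (st i) s' = f (st i) s ++ d by [].
have {}ne : f (st i) s <> f (st i) s' by [].
case: d Ed => [|x d] Ed; first by rewrite cats0 in Ed; case: ne.
have [isn] := f_spre Ed.
case: d Ed => [|y d] //= Ed; first by rewrite andbF.
rewrite prefix0s andbT => /andP[/eqP Ex /eqP Ey]; subst x y.
have {}E' : f (st i) s' ++ fstar (ct_tau i s') xs' = (f (st i) s ++ c) ++ r' by [].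
move: E'; rewrite Ed -!catA => /eqP; rewrite eqseq_cat // eqxx /=.
case: c sc E => [|a [|b [|]]] // _ E.
rewrite !eqseq_cons => /and3P[/eqP Ea /eqP Eb _]; subst a b.
have tau1 : ct_tau i s = ord_max by rewrite /= -/(st i) isn.
move: E; rewrite tau1 => E.
have {}E : f true x1 ++ fstar (ct_tau (ord_max : 'I_(ct_n F)) x1) xs =
  [:: false, false & r] by [].
by case: (f_hd x1) E => -[q ->].
Qed.

Lemma two_tables_AIFV : inAIFV F.
Proof.
split=> //; split; first by move=> i; exact: two_tables_inj.
split.
  move=> i s; split=> /Pbark1P[s' /prefixP[r]]; rewrite -!catA => E;
    by have [_] := f_spre E.
split.
  move=> i s s' E.
  by have [] := @f_spre (st i) s s' false [::] E.
split.
  move=> i s; split; last by move/Pbark0E => H; rewrite /= -/(st i) H.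
  move=> H; rewrite /= -/(st i); case: ifP => // inns; case: H.
  by apply/Pbark0E.
have f1 (i : 'I_(ct_n F)) s : val i = 1%N -> ct_f i s = f true s.
  by move=> /= ->.
split.
  by move=> i s i1; rewrite f1 //; case: (f_hd s) => -[r ->].
split.
  move=> i i1 /Pbark1P[s]; rewrite /st i1 /=.
  by case: (f_hd s) => -[r ->].
move=> i b [c [[sc [s [xs [pf sp]]]] uni]].
have [pb /eqP nb] := sp.
have [[s0 H]|[s1 [s2 [H1 H2]]]|[i1 ->]] :=
  @f_branch (st i) s b (pre_prefix pb) nb.
- left; exists s0; case: H => ->; first by exists [::]; rewrite cats0.
  by exists [:: false].
(* Two children would put both bits in the set assumed to be a singleton. *)
- have E1 := uni _ (Pbark1I H1); have E2 := uni _ (Pbark1I H2).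
  by rewrite E1 in E2.
- by right; split=> //; move/eqP: i1.
Qed.

(** * The two-state Markov chain *)

Section Chain.
Variables (R : realType) (mu : S -> R).
Hypotheses (mu_gt0 : forall s, 0 < mu s) (mu1 : \sum_s mu s = 1).

Definition inn_prob b : R := \sum_s mu s * (inn b s)%:R.

Hypothesis inn1_lt1 : inn_prob true < 1.

Lemma inn_prob_ge0 b : 0 <= inn_prob b.
Proof. by apply: sumr_ge0 => s _; rewrite mulr_ge0 // ltW. Qed.

Lemma two_tables_Qmat1 (i : 'I_(ct_n F)) : Qmat mu F i ord_max = inn_prob (st i).
Proof.
rewrite mxE /inn_prob big_mkcond; apply: eq_bigr => s _ /=.
by rewrite -/(st i); case: (inn _ _); rewrite ?eqxx ?mulr1 ?mulr0.
Qed.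

Lemma sum_I2 (g : 'I_2 -> R) : \sum_i g i = g ord0 + g ord_max.
Proof.
rewrite big_ord_recl big_ord1; congr (_ + g _); exact: val_inj.
Qed.

Lemma two_tables_Qmat0 (i : 'I_(ct_n F)) :
  Qmat mu F i (ord0 : 'I_2) = 1 - inn_prob (st i).
Proof.
by rewrite -two_tables_Qmat1 -(@Qmat_sum R S mu mu1 F i) [X in X - _]sum_I2 addrK.
Qed.

(** The equation is the balance at the second state; the balance at the first follows because the
    rows of the matrix sum to 1. *)
Lemma two_tables_stationary (pi : 'rV[R]_2) : stationary mu (F := F) pi <->
  pi 0 ord_max * (1 + inn_prob false - inn_prob true) = inn_prob false /\
  pi 0 ord0 = 1 - pi 0 ord_max.
Proof.
split.
  case=> piQ; rewrite sum_I2 => pi1.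
  move/rowP: piQ => /(_ ord_max); rewrite mxE sum_I2 !two_tables_Qmat1 /st /=.
  have -> : pi 0 ord0 = 1 - pi 0 ord_max by rewrite -pi1 addrK.
  by move=> E; split=> //; rewrite -[X in _ = X]subr0; move: E; lra.
case=> E E0; split; last by rewrite sum_I2 E0 subrK.
apply/rowP => j; rewrite mxE sum_I2.
have [->|->] : j = ord_max \/ j = ord0.
  by case: j => [[|[|]]] // ?; [right|left]; exact: val_inj.
- by rewrite !two_tables_Qmat1 /st /= E0; lra.
- by rewrite !two_tables_Qmat0 /st /= E0; lra.
Qed.

Lemma two_tables_regular : regular mu F.
Proof.
have D0 : 1 + inn_prob false - inn_prob true != 0.
  by rewrite gt_eqF //; have := inn_prob_ge0 false; have := inn1_lt1; lra.
pose q := inn_prob false / (1 + inn_prob false - inn_prob true).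
exists (\row_(j < 2) if j == ord_max then q else 1 - q); split.
  by apply/two_tables_stationary; rewrite !mxE /= divfK.
move=> pi /two_tables_stationary[E E0].
have E1 : pi 0 (ord_max : 'I_2) = q by apply: (mulIf D0); rewrite E divfK.
apply/rowP => j; rewrite mxE.
case: eqVneq => [->//|]; case: j => [[|[|]]] // ? _.
rewrite -E1 -E0; congr (pi 0 _); exact: val_inj.
Qed.

Lemma two_tables_avgL (pi : 'rV[R]_(ct_n F)) (d Ls : R) : stationary mu pi ->
  \sum_s mu s * (size (f false s))%:R + d * inn_prob false = Ls ->
  \sum_s mu s * (size (f true s))%:R + d * inn_prob true = Ls + d ->
  avgL mu pi = Ls.
Proof.
move=> /two_tables_stationary[E E0] L0 L1; rewrite /avgL sum_I2 E0.
have Li_sum (i : 'I_2) : Li mu (F := F) i = \sum_s mu s * (size (f (st i) s))%:R.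
  by apply: eq_bigr => s _; rewrite mulrC.
rewrite !Li_sum /st /=.
have -> : \sum_s mu s * (size (f false s))%:R = Ls - d * inn_prob false by rewrite -L0 addrK.
have -> : \sum_s mu s * (size (f true s))%:R = Ls + d - d * inn_prob true by rewrite -L1 addrK.
(* The coefficient of [d] is the balance equation of [pi], hence zero. *)
transitivity (Ls + d * (pi 0 ord_max * (1 + inn_prob false - inn_prob true) - inn_prob false)).
  by ring.
by rewrite E subrr mulr0 addr0.
Qed.

End Chain.
End TwoTables.

(** * Optimality of the balanced pair of trees *)

Lemma tree_of_seq (S : eqType) (X : seq S) : X != [::] ->
  exists t, perm_eq (syms t) X.
Proof.
elim: X => // a X IH _; have [->|/IH[t pt]] := eqVneq X [::]; first by exists (Leaf a).
by exists (Hole a t); rewrite /= perm_cons.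
Qed.

Theorem theorem1 (R : realType) (S : finType) (mu : S -> R) :
  (2 <= #|S|)%N ->
  (forall s : S, 0 < mu s <= 1) ->
  \sum_(s : S) mu s = 1 ->
  exists F : codeTuple S, inFopt mu F /\ inAIFV F.
Proof.
move=> S2 mu01 mu1; have mu_gt0 s : 0 < mu s by case/andP: (mu01 s).
have wS : wt mu (enum S) = 1 by exact: wt_enum.
pose l0 := [seq t <- trees S #|S| | perm_eq (syms t) (enum S)].
pose l1 := [seq p <- [seq (u, v) | u <- trees S #|S|, v <- trees S #|S|]
  | perm_eq (syms p.1 ++ syms p.2) (enum S)].
have l0P t : (t \in l0) = perm_eq (syms t) (enum S).
  rewrite mem_filter; case: (boolP (perm_eq _ _)) => //= pt.
  by rewrite mem_trees // cardE (perm_size pt).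
have l1P u v : ((u, v) \in l1) = perm_eq (syms u ++ syms v) (enum S).
  rewrite mem_filter /=; case: (boolP (perm_eq _ _)) => //= pt.
  have := perm_size pt; rewrite size_cat -cardE => szE.
  by rewrite allpairs_f // mem_trees // -szE ?leq_addr ?leq_addl.
have [u0 [v0 uv0]] : exists u v : tree S, perm_eq (syms u ++ syms v) (enum S).
  move: S2; rewrite cardE; case: (enum S) => [|a [|b X]] // _.
  have [t pt] := @tree_of_seq _ (b :: X) isT.
  by exists (Leaf a), t; rewrite /= perm_cons.
have l0n : l0 != [::].
  by apply/eqP => E; have := l0P (Br u0 v0); rewrite /= uv0 E.
have l1n : l1 != [::] by apply/eqP => E; have := l1P u0 v0; rewrite uv0 E.
have [] := @minmax_bias R _ _ l0 l1 (len mu) (hol mu)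
    (fun p => len1 mu p.1 p.2) (fun p => hol mu p.1 + hol mu p.2) l0n l1n.
- by move=> t _; exact: hol_ge0.
- move=> [u v]; rewrite l1P /= => /(wt_perm mu); rewrite wS wt_cat => <-.
  by rewrite ltrD // hol_lt.
(* Hanging [u] at 0 instead of 01 makes one tree of the pair and saves [wt (syms u)]. *)
- move=> [u v]; rewrite l1P => uv; exists (Br u v); first by rewrite l0P.
  by have := wt_ge0 mu_gt0 (syms u); rewrite /len1 /=; lra.
move=> d [t0 [[u1 v1] [d_ge0 t0l uv1l opt0 [opt1 eqd]]]].
rewrite l0P in t0l; rewrite l1P in uv1l; rewrite /= in opt1 eqd.
have U0 : uniq (syms t0) by rewrite (perm_uniq t0l) enum_uniq.
have U1 : uniq (syms u1 ++ syms v1) by rewrite (perm_uniq uv1l) enum_uniq.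
have uu1 : uniq (syms u1) by move: U1; rewrite cat_uniq => /and3P[].
have uv1 : uniq (syms v1) by move: U1; rewrite cat_uniq => /and3P[].
have in0 s : s \in syms t0 by rewrite (perm_mem t0l) mem_enum.
have in1 s : s \in syms u1 = false -> s \in syms v1.
  by move=> E; have := mem_enum S s; rewrite -(perm_mem uv1l) mem_cat E.
have nin s := @cat_uniq_notin _ u1 v1 s U1.
pose f (b : bool) := if b then cw1 u1 v1 else cw t0.
(* The extra bit on the codewords from [u1] does not change which symbols are inner, so [Br u1 v1]
   supplies the flags. *)
pose inn (b : bool) := if b then inner (Br u1 v1) else inner t0.
have f_pre b s s' : prefix (f b s) (f b s') ->
    s = s' \/ inn b s /\ prefix (f b s ++ [:: false; false]) (f b s').
  case: b => /=; last exact: cw_pre.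
  rewrite /cw1; case: ifP => su; case: ifP => su' //=; first exact: cw_pre.
  by apply: cw_pre => //; exact: in1.
have f_ext b s : inn b s ->
    exists s', prefix (f b s ++ [:: false; false]) (f b s').
  case: b => /=; last by move=> /(inner_ext U0 (in0 s))[s' _]; exists s'.
  rewrite /cw1; case: ifP => su.
    by move=> /(inner_ext uu1 su)[s' su' H]; exists s'; rewrite su'.
  by move=> /(inner_ext uv1 (in1 _ su))[s' sv' H]; exists s'; rewrite nin.
have f_hd s : (exists r, f true s = [:: false, true & r]) \/
    exists r, f true s = true :: r.
  by rewrite /= /cw1; case: ifP => _; [left|right]; eexists.
have f_branch b s p : prefix p (f b s) -> p != f b s ->
    [\/ exists s0, p = f b s0 \/ p = f b s0 ++ [:: false],
        exists s1 s2, prefix (p ++ [:: false]) (f b s1) /\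
          prefix (p ++ [:: true]) (f b s2)
      | b /\ p = [:: false]].
  case: b => /=; last first.
    move=> pp np.
    have [[s0 _ H]|[s1 [s2 [_ _ H1 H2]]]] := cw_branch U0 (in0 s) pp np.
      by constructor 1; exists s0.
    by constructor 2; exists s1, s2.
  have [s1 s1u] := syms_ne u1; have [s2 s2v] := syms_ne v1.
  case: p => [|x p].
    by constructor 2; exists s1, s2; rewrite /cw1 s1u nin //= !prefix0s.
  rewrite {1 2}/cw1; case: ifP => su.
    (* The node 0 of the second table has the single child 01: the exception granted by the AIFV
       definition. *)
    case: p => [|y p] /=; first by rewrite andbT => /eqP -> _; constructor 3.
    rewrite !eqseq_cons => /and3P[/eqP -> /eqP ->] pp; rewrite !eqxx /= => np.
    have [[s0 s0u H]|[s3 [s4 [s3u s4u H1 H2]]]] := cw_branch uu1 su pp np.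
      constructor 1; exists s0; rewrite /cw1 s0u.
      by case: H => ->; [left|right].
    by constructor 2; exists s3, s4; rewrite /cw1 s3u s4u.
  rewrite /= eqseq_cons => /andP[/eqP ->] pp; rewrite eqxx /= => np.
  have [[s0 s0v H]|[s3 [s4 [s3v s4v H1 H2]]]] := cw_branch uv1 (in1 _ su) pp np.
    constructor 1; exists s0; rewrite /cw1 nin //.
    by case: H => ->; [left|right].
  by constructor 2; exists s3, s4; rewrite /cw1 !nin.
have p0 : inn_prob inn mu false = hol mu t0.
  by rewrite -(inner_hol mu U0) (perm_big _ t0l) sum_over_enum.
have p1 : inn_prob inn mu true = hol mu u1 + hol mu v1.
  by rewrite -[RHS]/(hol mu (Br u1 v1)) -(inner_hol mu (t := Br u1 v1)) //=
    (perm_big _ uv1l) sum_over_enum.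
have p1_lt1 : inn_prob inn mu true < 1.
  by rewrite p1 -wS -(wt_perm mu uv1l) wt_cat ltrD // hol_lt.
exists (two_tables f inn); split; last exact: two_tables_AIFV.
split; first split.
- exact: two_tables_regular.
- by split; [exact: two_tables_extendable|exact: two_tables_decodable].
move=> F' [reg' [ext' dec']] pi pi' stpi stpi'.
pose Ls := len mu t0 + d * hol mu t0.
(* By the balance [eqd], both tables satisfy the Bellman equation with value [Ls] and biases 0 and
   [d]. *)
have -> : avgL mu pi = Ls.
  apply: (two_tables_avgL mu1 (d := d) stpi).
    by rewrite p0 /Ls -(cw_len mu U0) (perm_big _ t0l) sum_over_enum.
  by rewrite p1 -eqd -(cw1_len mu U1) (perm_big _ uv1l) sum_over_enum.
have opt0' t : perm_eq (syms t) (enum S) -> Ls <= len mu t + d * hol mu t.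
  by rewrite -l0P => /opt0.
have opt1' u v : perm_eq (syms u ++ syms v) (enum S) ->
    Ls + d <= len1 mu u v + d * (hol mu u + hol mu v).
  by rewrite -l1P => /opt1; rewrite eqd.
have bound i := table_bound S2 mu_gt0 mu1 d_ge0 opt0' opt1' i ext' dec'.
have pi'0 := stationary_ge0 mu_gt0 mu1 reg' stpi'.
pose g i := bias d (@lookahead S F' i).
have [_ sum1] := stpi'.
(* The table inequalities are averaged with the nonnegative weights [pi']; by stationarity the mean
   of [g] then appears on both sides and cancels. *)
have step : \sum_i pi' 0 i * (Ls + g i) <=
    \sum_i pi' 0 i * (Li mu i + \sum_s mu s * g (ct_tau i s)).
  apply: ler_sum => i _; apply: ler_wpM2l => //.
  apply: le_trans (bound i) _.
  rewrite /Li -big_split /= ler_sum // => s _.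
  by rewrite mulrDr [mu s * _]mulrC.
move: step; under eq_bigr do rewrite mulrDr.
under [leRHS]eq_bigr do rewrite mulrDr.
rewrite !big_split /= (stationary_sum g stpi') -mulr_suml sum1 mul1r.
by rewrite lerD2r.
Qed.
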